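(* For every graph $H$ with $i$ isolated vertices and $q$ edges, every graph $G$ with average degree at least $i+6.929q$ contains $H$ as a minor.
   Context: All graphs are finite and simple. A graph $H$ is a minor of $G$ if a graph isomorphic to $H$ can be obtained from a subgraph of $G$ by contracting edges. *)

(* Defs.v *)
From HB Require Import structures.
From mathcomp Require Import all_boot all_order all_algebra.
Set Implicit Arguments. Unset Strict Implicit. Unset Printing Implicit Defensive.
Import Order.TTheory GRing.Theory Num.Theory.

Definition simple_graph (V : finType) (e : rel V) : Prop :=
  symmetric e /\ irreflexive e.

Definition deg (V : finType) (e : rel V) (v : V) : nat := #|[set w | e v w]|.

Definition edge_set (V : finType) (e : rel V) : {set {set V}} :=
  [set A : {set V} | [exists x, exists y, e x y && (A == [set x; y])]].

Definition num_edges (V : finType) (e : rel V) : nat := #|edge_set e|.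

Definition isolated_vertices (V : finType) (e : rel V) : {set V} :=
  [set v | [forall w, ~~ e v w]].

Definition num_isolated (V : finType) (e : rel V) : nat := #|isolated_vertices e|.

(* Average degree (sum of degrees divided by number of vertices), in rat.
   For the empty graph this is 0/0 = 0 in rat. *)
Definition average_degree (V : finType) (e : rel V) : rat :=
  ((\sum_(v : V) deg e v)%:R / #|V|%:R)%R.

Definition induced_rel (V : finType) (e : rel V) (A : {set V}) : rel V :=
  [rel x y | [&& x \in A, y \in A & e x y]].

Definition connected_in (V : finType) (e : rel V) (A : {set V}) : Prop :=
  A != set0 /\ {in A &, forall x y, connect (induced_rel e A) x y}.

(* H is a minor of G: the standard branch-set ("minor model") formulation of
   "a graph isomorphic to H is obtained from a subgraph of G by contracting
   edges": disjoint nonempty connected branch sets phi v, one for each vertex v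
   of H, with some G-edge between phi u and phi v whenever uv is an edge of H. *)
Definition is_minor (VH : finType) (eH : rel VH) (VG : finType) (eG : rel VG)
  : Prop :=
  exists phi : VH -> {set VG},
    [/\ forall v, connected_in eG (phi v),
        forall u v, u != v -> [disjoint phi u & phi v]
      & forall u v, eH u v ->
          exists x, exists y, [/\ x \in phi u, y \in phi v & eG x y]].

(* Main.v *)
(**
The constant 6 suffices.  Tree components of H are removed first: they embed
greedily in a subgraph of large minimum degree of G, and deleting their at most two
vertices per edge lowers the average degree by less than 6 per edge.

A graph with q edges and no tree component has a model with at most q vertices in any
graph Z in which every two vertices have q - 1 common neighbours.  Place its vertices
one at a time, component by component, each next vertex adjacent to an earlier one: a
vertex with b >= 1 earlier neighbours costs max(1, b - 1) <= b vertices, and in each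
component the root, which costs 1, is paid for by the first vertex with b >= 2.

To find Z, let d = i + 6q and contract or delete while e(G) >= d|G|/2.  When this
stops, the closed neighbourhood of a vertex of minimum degree has density at least
1/2, hence contains either a subset of 6q + 1 vertices of average degree at least 3q
or at most 6q vertices of average degree above 3q; the isolated vertices of H fit
outside since |G| > d.  Inside, contract or delete again as long as the average degree on n
vertices is at least g(n) = q + (q - 1)(1/q + ... + 1/(n - 1)), which starts true
because g(6q + 1) <= 3q (morally 1 + ln 6 < 3) and cannot hold at n = q.  Minimality
now makes the closed neighbourhood of a minimum degree vertex a suitable Z.
*)
Require Import Defs.
From mathcomp Require Import all_boot all_order all_algebra.
From mathcomp Require Import zify ring lra.
Import Order.TTheory GRing.Theory Num.Theory.
Set Implicit Arguments. Unset Strict Implicit. Unset Printing Implicit Defensive.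

(** * Degrees inside a vertex set *)

(** Every graph that occurs is a relation together with a vertex set [X] of a fixed type, so that
    deletion and contraction stay in that type. *)
Definition nb (V : finType) (e : rel V) (X : {set V}) (u : V) : {set V} :=
  [set w in X | e u w].

(** For a simple graph, twice the number of edges inside [X]. *)
Definition dsum (V : finType) (e : rel V) (X : {set V}) : nat :=
  \sum_(u in X) #|nb e X u|.

Lemma nbD1 (V : finType) (e : rel V) (X : {set V}) (u v : V) :
  #|nb e X u| = (v \in nb e X u) + #|nb e (X :\ v) u|.
Proof.
rewrite (cardsD1 v (nb e X u)); congr (_ + #|pred_of_set _|).
by apply/setP=> w; rewrite !inE andbA.
Qed.

Lemma nb_ltn (V : finType) (e : rel V) (X : {set V}) (u : V) :
  irreflexive e -> u \in X -> #|nb e X u| < #|X|.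
Proof.
move=> irr uX; apply: proper_card; apply/properP; split.
  by apply/subsetP=> w; rewrite inE => /andP[].
by exists u => //; rewrite inE irr andbF.
Qed.

Lemma dsum_bound (V : finType) (e : rel V) (X : {set V}) :
  irreflexive e -> dsum e X <= #|X| * #|X|.-1.
Proof.
move=> irr; rewrite -sum_nat_const; apply: leq_sum => u uX.
by have := nb_ltn irr uX; case: #|X|.
Qed.

Lemma dsum_del (V : finType) (e : rel V) (X : {set V}) (v : V) :
  simple_graph e -> v \in X -> dsum e X = dsum e (X :\ v) + 2 * #|nb e X v|.
Proof.
move=> [sym irr] vX; rewrite /dsum (big_setD1 v vX) /=.
under eq_bigr => u uX do rewrite (nbD1 _ _ _ v).
rewrite big_split /=.
have -> : \sum_(u in X :\ v) (v \in nb e X u) = #|nb e X v|.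
  rewrite -sum1_card big_mkcond [RHS]big_mkcond; apply: eq_bigr => u _ /=.
  rewrite !inE vX sym /=; have [->|_] := eqVneq u v; first by rewrite irr andbF.
  by case: (u \in X); case: (e v u).
by lia.
Qed.

Lemma even_dsum (V : finType) (e : rel V) (X : {set V}) :
  simple_graph e -> ~~ odd (dsum e X).
Proof.
move=> sg; have [n] := ubnP #|X|; elim: n X => // n IH X leXn.
have [->|[v vX]] := set_0Vmem X; first by rewrite /dsum big_set0.
rewrite (dsum_del sg vX) mul2n oddD odd_double addbF; apply: IH.
by rewrite (cardsD1 v X) vX in leXn.
Qed.

Lemma exists_min_degree (V : finType) (e : rel V) (X : {set V}) :
  X != set0 ->
  exists2 v, v \in X & #|X| * #|nb e X v| <= dsum e X.
Proof.
move=> /set0Pn[v0 v0X].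
have [v vX vmin] := @arg_minnP _ v0 (mem X) (fun v => #|nb e X v|) v0X.
by exists v => //; rewrite -sum_nat_const; apply: leq_sum => u /vmin.
Qed.

(** * Contracting an edge *)

(* If the graph has vertex set [X], the contracted graph has vertex set [X :\ y]. *)
Definition contract (V : finType) (e : rel V) (x y : V) : rel V :=
  [rel u w | (u != w) && [|| e u w, (u == x) && e y w | (w == x) && e y u]].

Lemma contract_simple (V : finType) (e : rel V) (x y : V) :
  simple_graph e -> simple_graph (contract e x y).
Proof.
move=> [sym irr]; split=> [u w|u]; rewrite /contract /= ?eqxx //.
by rewrite eq_sym sym; case: (w == u); case: (e w u); rewrite //= orbC.
Qed.

(** The contraction loses the edge [xy] itself and, for each common neighbour of [x] and [y], one of
    two edges that become parallel. *)
Lemma dsum_contract (V : finType) (e : rel V) (X : {set V}) (x y : V) :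
  simple_graph e -> x \in X -> y \in X -> e x y ->
  dsum e X <=
    dsum (contract e x y) (X :\ y) + 2 + 2 * #|nb e X x :&: nb e X y|.
Proof.
move=> [sym irr] xX yX exy.
have nxy : x != y by apply: contraTneq exy => ->; rewrite irr.
have xXy : x \in X :\ y by rewrite !inE nxy.
rewrite /dsum (big_setD1 y yX) (big_setD1 x xXy) /= [in X in _ <= X](big_setD1 x xXy) /=.
set R := X :\ y :\ x; set T := nb e X x :&: nb e X y.
(* Any other vertex loses a neighbour only if it is adjacent to both [x] and [y]; if it is adjacent
   to [y] alone, [x] takes the place of [y]. *)
have rest : \sum_(u in R) #|nb e X u| <=
    \sum_(u in R) #|nb (contract e x y) (X :\ y) u| + #|T|.
  have leT : \sum_(u in R) (u \in T) <= #|T|.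
    rewrite -sum1_card big_mkcond [leqRHS]big_mkcond; apply: leq_sum => u _ /=.
    by case: (u \in R); case: (u \in T).
  apply: leq_trans (leq_add (leqnn _) leT); rewrite -big_split /=.
  apply: leq_sum => u; rewrite !inE => /and3P[nux nuy uX].
  rewrite uX /= ![e _ u]sym.
  have sub w : w != y -> w \in nb e X u -> w \in nb (contract e x y) (X :\ y) u.
    move=> nwy; rewrite !inE /contract /= nwy => /andP[-> euw]; rewrite euw /= andbT.
    by apply: contraTneq euw => <-; rewrite irr.
  case euy : (e u y); last first.
    rewrite andbF addn0; apply: subset_leq_card; apply/subsetP=> w wu.
    by apply: sub => //; apply: contraTneq wu => ->; rewrite inE euy andbF.
  have yu : y \in nb e X u by rewrite inE yX.
  rewrite andbT; case eux : (e u x).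
    rewrite (cardsD1 y (nb e X u)) yu addnC leq_add2r; apply: subset_leq_card.
    by apply/subsetP=> w; rewrite 2!inE => /andP[nwy /(sub _ nwy)].
  rewrite addn0 (cardsD1 y (nb e X u)) yu.
  have -> : true + #|nb e X u :\ y| = #|x |: (nb e X u :\ y)|.
    by rewrite cardsU1 !inE eux !andbF.
  apply: subset_leq_card; apply/subsetP=> w; rewrite in_setU1 => /orP[/eqP->|].
    by rewrite !inE /contract /= nxy xX /= nux eqxx (sym y u) euy /= !orbT.
  by rewrite in_setD1 => /andP[nwy /(sub _ nwy)].
have ends : #|nb e X x| + #|nb e X y| <=
    #|nb (contract e x y) (X :\ y) x| + 2 + #|T|.
  rewrite -cardsUI leq_add2r.
  apply: (@leq_trans #|[set x; y] :|: nb (contract e x y) (X :\ y) x|).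
    apply: subset_leq_card; apply/subsetP=> w; rewrite !inE /contract /= eqxx /= [x == w]eq_sym.
    have [//|/= nwx] := eqVneq w x; have [//|/= nwy] := eqVneq w y.
    by rewrite !orbF; case: (w \in X).
  by rewrite addnC; apply: leq_trans (leq_card_setU _ _) _; rewrite leq_add2r cards2 nxy.
by lia.
Qed.

(** * Minor models within vertex sets *)

(** Relative to a part of H and a part of G, so that models of different parts can be put
    together. *)
Definition model (VH : finType) (eH : rel VH) (A : {set VH})
    (VG : finType) (eG : rel VG) (X : {set VG}) : Prop :=
  exists phi : VH -> {set VG},
    [/\ forall v, v \in A -> phi v \subset X,
        forall v, v \in A -> connected_in eG (phi v),
        forall u v, u \in A -> v \in A -> u != v -> [disjoint phi u & phi v]
      & forall u v, u \in A -> v \in A -> eH u v ->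
          exists x, exists y, [/\ x \in phi u, y \in phi v & eG x y]].

Lemma model_sub (VH : finType) (eH : rel VH) (A : {set VH})
    (VG : finType) (eG : rel VG) (X Y : {set VG}) :
  X \subset Y -> model eH A eG X -> model eH A eG Y.
Proof.
move=> sXY [phi [sub con dis adj]]; exists phi; split=> // v vA.
exact: subset_trans (sub v vA) sXY.
Qed.

Lemma model_contract (VH : finType) (eH : rel VH) (A : {set VH})
    (VG : finType) (eG : rel VG) (X : {set VG}) (x y : VG) :
  simple_graph eG -> y \in X -> eG x y ->
  model eH A (contract eG x y) (X :\ y) -> model eH A eG X.
Proof.
move=> [sym irr] yX exy [phi [sub con dis adj]].
(* After the contraction [x] stands for the whole edge, so the branch set containing [x] takes in
   [y]. *)
pose psi v := if x \in phi v then y |: phi v else phi v.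
have phi_psi v a : a \in phi v -> a \in psi v.
  by rewrite /psi; case: ifP => // _; rewrite in_setU1 orbC => ->.
have y_psi v : x \in phi v -> y \in psi v.
  by rewrite /psi => ->; rewrite setU11.
have y_phi v : v \in A -> y \notin phi v.
  by move=> vA; apply/negP=> /(subsetP (sub v vA)); rewrite !inE eqxx.
exists psi; split.
- move=> v vA; have := subset_trans (sub v vA) (subsetDl _ _).
  by rewrite /psi; case: ifP => // _ sX; rewrite subUset sub1set yX.
- move=> v vA; have [/set0Pn[a av] conn] := con v vA.
  split; first by apply/set0Pn; exists a; apply: phi_psi.
  (* An edge of the contracted graph that is missing in [eG] ends in [x] and comes from an edge at
     [y]; a detour through [y] replaces it. *)
  have step : {in phi v &, forall b c, connect (induced_rel eG (psi v)) b c}.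
    move=> b0 c0 bv0 cv0; move: (conn b0 c0 bv0 cv0); apply: connect_sub => b c /=.
    case/and3P=> bv cv /andP[_]; have bp := phi_psi _ _ bv; have cp := phi_psi _ _ cv.
    case/or3P=> [ebc|/andP[/eqP eb eyc]|/andP[/eqP ec eyb]].
    - by apply: connect1; rewrite /induced_rel /= bp cp.
    - have yv : y \in psi v by apply: y_psi; rewrite -eb.
      apply: (@connect_trans _ _ y); apply: connect1; rewrite /induced_rel /= yv ?bp ?cp //.
      by rewrite eb.
    - have yv : y \in psi v by apply: y_psi; rewrite -ec.
      apply: (@connect_trans _ _ y); apply: connect1; rewrite /induced_rel /= yv ?bp ?cp //.
        by rewrite sym.
      by rewrite ec sym.
  have psi_phi b : b \in psi v -> x \in phi v /\ b = y \/ b \in phi v.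
    rewrite /psi; case: ifP => [xv|_]; last by right.
    by rewrite in_setU1 => /orP[/eqP->|]; [left|right].
  have xy : x \in phi v -> connect (induced_rel eG (psi v)) x y.
    by move=> xv; apply: connect1; rewrite /induced_rel /= phi_psi ?y_psi.
  have yx : x \in phi v -> connect (induced_rel eG (psi v)) y x.
    by move=> xv; apply: connect1; rewrite /induced_rel /= sym y_psi ?phi_psi.
  move=> b c /psi_phi[[xv ->]|bv] /psi_phi[[xv' ->]|cv].
  - exact: connect0.
  - exact: connect_trans (yx xv) (step _ _ xv cv).
  - exact: connect_trans (step _ _ bv xv') (xy xv').
  - exact: step.
- move=> u v uA vA nuv; have d := dis u v uA vA nuv.
  have dxy : ~~ ((x \in phi u) && (x \in phi v)).
    by apply/negP=> /andP[xu xv]; have := disjointFr d xu; rewrite xv.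
  have dU1 (B C : {set VG}) : y \notin C -> [disjoint B & C] -> [disjoint y |: B & C].
    by rewrite !disjoints_subset subUset sub1set inE => -> ->.
  move: dxy; rewrite /psi; case: ifP => xu; case: ifP => xv //= _.
    by apply: dU1 => //; apply: y_phi.
  by rewrite disjoint_sym; apply: dU1; rewrite 1?disjoint_sym ?y_phi.
move=> u v uA vA /(adj u v uA vA) [a [b [au bv /andP[_ /or3P[eab|/andP[/eqP ea eyb]|/andP[/eqP eb eya]]]]]].
- by exists a, b; split=> //; apply: phi_psi.
- by exists y, b; split=> //; [apply: y_psi; rewrite -ea|apply: phi_psi].
- by exists a, y; split; [apply: phi_psi|apply: y_psi; rewrite -eb|rewrite sym].
Qed.

Lemma model_union (VH : finType) (eH : rel VH) (A B : {set VH})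
    (VG : finType) (eG : rel VG) (X Y : {set VG}) :
  simple_graph eG -> [disjoint X & Y] -> [disjoint A & B] ->
  (forall u v, u \in A -> v \in B -> ~~ eH u v /\ ~~ eH v u) ->
  model eH A eG X -> model eH B eG Y -> model eH (A :|: B) eG (X :|: Y).
Proof.
move=> sg dXY dAB nAB [phi [sub con dis adj]] [psi [sub' con' dis' adj']].
have BA v : v \in B -> v \in A = false by move=> vB; rewrite (disjointFl dAB).
exists (fun v => if v \in A then phi v else psi v); split.
- move=> v; rewrite inE; case: ifP => [vA _|_ /= vB].
    exact: subset_trans (sub v vA) (subsetUl _ _).
  exact: subset_trans (sub' v vB) (subsetUr _ _).
- by move=> v; rewrite inE; case: ifP => [vA _|_ /= vB]; [apply: con|apply: con'].
- have dXYuv u v : u \in A -> v \in B -> [disjoint phi u & psi v].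
    move=> uA vB; apply: disjointWl (sub u uA) _.
    exact: disjointWr (sub' v vB) dXY.
  move=> u v; rewrite !inE; case: ifP => uA /= uB; case: ifP => vA /= vB nuv.
  + exact: dis.
  + exact: dXYuv.
  + by rewrite disjoint_sym; apply: dXYuv.
  + exact: dis'.
move=> u v; rewrite !inE; case: ifP => uA /= uB; case: ifP => vA /= vB euv.
- exact: adj.
- by have [] := nAB u v uA vB; rewrite euv.
- by have [] := nAB v u vA uB; rewrite euv.
- exact: adj'.
Qed.

(** * Unions of components *)

(** For a symmetric relation these are exactly the unions of connected components. *)
Definition closed_set (V : finType) (e : rel V) (B : {set V}) : bool :=
  [forall u in B, [set v | e u v] \subset B].

Lemma closed_setP (V : finType) (e : rel V) (B : {set V}) :
  reflect (forall u v, u \in B -> e u v -> v \in B) (closed_set e B).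
Proof.
apply: (iffP forall_inP) => [H u v uB euv|H u uB].
  by apply: (subsetP (H u uB)); rewrite inE.
by apply/subsetP=> v; rewrite inE; apply: H.
Qed.

Lemma closed_setD (V : finType) (e : rel V) (A B : {set V}) :
  symmetric e -> closed_set e A -> closed_set e B -> closed_set e (A :\: B).
Proof.
move=> sym /closed_setP cA /closed_setP cB; apply/closed_setP=> u v.
rewrite !inE => /andP[nuB uA] euv; rewrite (cA u v) // andbT.
by apply: contra nuB => vB; apply: (cB v u); rewrite // sym.
Qed.

Lemma dsum_closedD (V : finType) (e : rel V) (X A : {set V}) :
  symmetric e -> closed_set e A -> A \subset X ->
  dsum e X = dsum e A + dsum e (X :\: A).
Proof.
move=> sym /closed_setP cA sAX; rewrite /dsum (big_setID A) /= (setIidPr sAX).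
congr (_ + _); apply: eq_bigr => u; rewrite ?inE => uA;
  apply: eq_card => w; rewrite !inE; case euw: (e u w); rewrite ?andbF ?andbT //.
  by have wA := cA u w uA euw; rewrite wA (subsetP sAX).
case/andP: uA => nuA _; suff /negPf-> : w \notin A by [].
by apply: contra nuA => wA; apply: (cA w u); rewrite // sym.
Qed.

Lemma dsumU1 (V : finType) (e : rel V) (S : {set V}) (x : V) :
  simple_graph e -> x \notin S -> dsum e (x |: S) = dsum e S + 2 * #|nb e S x|.
Proof.
move=> sg xS; rewrite (dsum_del sg (setU11 x S)) setU1K //.
suff -> : nb e (x |: S) x = nb e S x by [].
apply/setP=> w; rewrite !inE; have [->|//] := eqVneq w x.
by case: sg => _ ->; rewrite !andbF.
Qed.

Lemma dsum_sub (V : finType) (e : rel V) (A B : {set V}) :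
  A \subset B -> dsum e A <= dsum e B.
Proof.
move=> sAB; rewrite /dsum [leqRHS](big_setID A) /= (setIidPr sAB).
apply: leq_trans (leq_addr _ _); apply: leq_sum => u _; apply: subset_leq_card.
by apply/subsetP=> w; rewrite !inE => /andP[/(subsetP sAB)-> ->].
Qed.

Lemma exists_boundary (V : finType) (e : rel V) (S C : {set V}) :
  symmetric e -> closed_set e C -> S \subset C -> ~~ closed_set e S ->
  exists x, [/\ x \in C, x \notin S & 0 < #|nb e S x|].
Proof.
move=> sym /closed_setP cC sSC; rewrite negb_forall_in => /exists_inP[u uS].
case/subsetPn=> x; rewrite inE => eux xS; exists x; split=> //.
  by apply: (cC u) => //; apply: (subsetP sSC).
by apply/card_gt0P; exists u; rewrite inE uS sym.
Qed.

(** * Placing one vertex at a time *)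

(** As [D] lies in [U] and misses [N], at most [#|U| - #|D|] elements of [N] are used up. Typically
    [D] holds the one or two vertices whose (common) neighbourhood is [N]. *)
Lemma exists_fresh (V : finType) (D N U : {set V}) :
  D \subset U -> [disjoint D & N] -> #|U| < #|N| + #|D| ->
  exists2 k, k \in N & k \notin U.
Proof.
move=> sDU dDN lt; suff /subsetPn[k kN kU] : ~~ (N \subset U) by exists k.
apply: contraTN lt => sNU; rewrite -leqNgt -cardsUI setIC.
rewrite (disjoint_setI0 dDN) cards0 addn0; apply: subset_leq_card.
by rewrite subUset sNU.
Qed.

(* The branch set [phi v] spans a star with centre [r v]; [u] bounds the total
   number of vertices used. *)
Definition star_model (VH : finType) (eH : rel VH) (S : {set VH})
    (VG : finType) (e : rel VG) (Z : {set VG}) (u : nat)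
    (r : VH -> VG) (phi : VH -> {set VG}) : Prop :=
  [/\ forall v, v \in S -> [/\ phi v \subset Z, r v \in phi v
        & forall a, a \in phi v -> a != r v -> e (r v) a],
      forall v w, v \in S -> w \in S -> v != w -> [disjoint phi v & phi w],
      forall v w, v \in S -> w \in S -> eH v w ->
        exists x, exists y, [/\ x \in phi v, y \in phi w & e x y]
    & #|\bigcup_(v in S) phi v| <= u].

Lemma star_model_model (VH : finType) (eH : rel VH) (S : {set VH})
    (VG : finType) (e : rel VG) (Z : {set VG}) (u : nat)
    (r : VH -> VG) (phi : VH -> {set VG}) :
  symmetric e -> star_model eH S e Z u r phi ->
  exists Y : {set VG}, [/\ Y \subset Z, #|Y| <= u & model eH S e Y].
Proof.
move=> sym [star dis adj card]; exists (\bigcup_(v in S) phi v); split=> //.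
  by apply/bigcupsP=> v /star[].
exists phi; split=> // v vS; first exact: bigcup_sup.
have [_ rv st] := star v vS; split; first by apply/set0Pn; exists (r v).
have toc a : a \in phi v -> connect (induced_rel e (phi v)) a (r v) /\
    connect (induced_rel e (phi v)) (r v) a.
  move=> av; have [->|nar] := eqVneq a (r v); first by split; apply: connect0.
  by split; apply: connect1; rewrite /induced_rel /= av rv ?[e a _]sym st.
by move=> a b /toc[ar _] /toc[_ rb]; apply: connect_trans ar rb.
Qed.

Lemma exists_connectors (VH VG : finType) (e : rel VG) (Z U : {set VG}) (a : VG)
    (T : {set VH}) (r : VH -> VG) (q : nat) :
  simple_graph e -> a \in U ->
  (forall y, y \in T -> [/\ r y \in U, r y != a
     & q <= #|nb e Z a :&: nb e Z (r y)|.+1]) ->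
  #|U| + #|T| <= q.+1 ->
  exists K : {set VG}, [/\ K \subset Z, [disjoint K & U], #|K| <= #|T|,
    forall k, k \in K -> e a k
  & forall y, y \in T -> exists2 k, k \in K & e (r y) k].
Proof.
move=> [sym irr] aU; have [n] := ubnP #|T|; elim: n T => // n IH T leTn HT leq.
have [->|[y yT]] := set_0Vmem T.
  exists set0; split; rewrite ?sub0set ?cards0 //.
  - by rewrite disjoints_subset sub0set.
  - by move=> k; rewrite inE.
  - by move=> y; rewrite inE.
have cT := cardsD1 y T; rewrite yT in cT.
have leT' : #|T :\ y| < n by lia.
have [|K [sKZ dKU cK aK rK]] := IH _ leT' (fun z zT => HT z (subsetP (subD1set T y) z zT)).
  by lia.
have [ryU nrya com] := HT y yT.
have [|||k] := @exists_fresh _ [set a; r y] (nb e Z a :&: nb e Z (r y)) (U :|: K).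
- by apply/subsetP=> z; rewrite !inE => /orP[]/eqP->; rewrite ?aU ?ryU.
- rewrite disjoints_subset; apply/subsetP=> z; rewrite !inE.
  by case/orP=> /eqP->; rewrite irr ?andbF.
- rewrite cards2 eq_sym nrya; have [+ _] := leq_card_setU U K.
  by move: cK cT leq com; clear; lia.
rewrite !inE negb_or => /andP[/andP[kZ eak] /andP[_ erk]] /andP[kU kK].
exists (k |: K); split.
- by rewrite subUset sub1set kZ.
- by rewrite disjoints_subset subUset sub1set inE kU -disjoints_subset.
- by rewrite cardsU1 kK; move: cK cT; clear; lia.
- by move=> z /setU1P[->|/aK].
move=> z zT; have [->|nzy] := eqVneq z y; first by exists k => //; apply: setU11.
have [|l lK erl] := rK z; first by rewrite !inE nzy.
by exists l => //; rewrite inE lK orbT.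
Qed.

(** The new star has centre [a]; the neighbours of [x] in [T] are reached through its leaves, at
    most one leaf for each. *)
Lemma star_model_add (VH : finType) (eH : rel VH) (S T : {set VH}) (x : VH)
    (VG : finType) (e : rel VG) (Z : {set VG}) (u q : nat)
    (r : VH -> VG) (phi : VH -> {set VG}) (a : VG) :
  simple_graph eH -> simple_graph e ->
  star_model eH S e Z u r phi -> x \notin S ->
  a \in Z -> a \notin \bigcup_(v in S) phi v ->
  T \subset S ->
  (forall y, y \in nb eH S x -> y \notin T -> e (r y) a) ->
  (forall y, y \in T -> q <= #|nb e Z a :&: nb e Z (r y)|.+1) ->
  (T != set0 -> u + 1 + #|T| <= q.+1) ->
  exists r' phi', star_model eH (x |: S) e Z (u + 1 + #|T|) r' phi'.
Proof.
move=> [symH irrH] sg [star dis adj card] xS aZ; set U := \bigcup_(v in S) phi v.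
move=> aU sTS eT comT leT; rewrite -/U in card; have [sym irr] := sg.
have inU v b : v \in S -> b \in phi v -> b \in U.
  by move=> vS; apply: (subsetP (bigcup_sup v vS)).
have rU y : y \in S -> r y \in U by move=> yS; have [_ /inU-> ] := star y yS.
have [K [sKZ dKU cK aK rK]] : exists K : {set VG}, [/\ K \subset Z,
    [disjoint K & a |: U], #|K| <= #|T|,
    forall k, k \in K -> e a k & forall y, y \in T -> exists2 k, k \in K & e (r y) k].
  have [T0|nT0] := eqVneq T set0.
    exists set0; split; rewrite ?sub0set ?cards0 //.
    - by rewrite disjoints_subset sub0set.
    - by move=> k; rewrite inE.
    - by move=> y; rewrite T0 inE.
  apply: (@exists_connectors _ _ e Z (a |: U) a T r q) => //; first exact: setU11.
    move=> y yT; have yS := subsetP sTS y yT; split; last exact: comT.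
      by rewrite inE rU ?orbT.
    by apply: contraNneq aU => <-; apply: rU.
  by rewrite cardsU1 aU; have := leT nT0; lia.
have nSx v : v \in S -> (v == x) = false.
  by move=> vS; apply: contraNF xS => /eqP<-.
pose r' v := if v == x then a else r v.
pose phi' v := if v == x then a |: K else phi v.
have disx v : v \in S -> [disjoint a |: K & phi v].
  move=> vS; rewrite disjoints_subset subUset sub1set inE.
  rewrite (contra (@inU v a vS) aU) -disjoints_subset /=.
  apply: disjointWr dKU; apply/subsetP=> b bv; rewrite inE (inU v) ?orbT //.
have adjx y : y \in S -> eH x y -> exists b, exists2 c, b \in a |: K & c \in phi y /\ e b c.
  move=> yS exy; have [_ ry _] := star y yS; have [yT|yT] := boolP (y \in T).
    have [k kK erk] := rK y yT; exists k, (r y); first by rewrite inE kK orbT.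
    by rewrite sym.
  exists a, (r y); first exact: setU11.
  by split; rewrite // sym; apply: eT; rewrite // inE yS.
exists r', phi'; rewrite /r' /phi'; split.
- move=> v /setU1P[->|vS]; last by rewrite nSx //; apply: star.
  rewrite eqxx; split; [by rewrite subUset sub1set aZ|exact: setU11|].
  by move=> b /setU1P[->|/aK //]; rewrite eqxx.
- move=> v w /setU1P[->|vS] /setU1P[->|wS]; rewrite ?eqxx ?nSx //.
  + by move=> _; apply: disx.
  + by move=> _; rewrite disjoint_sym; apply: disx.
  + exact: dis.
- move=> v w /setU1P[->|vS] /setU1P[->|wS]; rewrite ?eqxx ?nSx ?irrH //.
  + by case/(adjx w wS)=> b [c bK [cw ebc]]; exists b, c.
  + rewrite symH; case/(adjx v vS)=> b [c bK [cw ebc]]; exists c, b.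
    by rewrite sym.
  + exact: adj.
rewrite (bigcup_setU) big_set1 eqxx.
rewrite (_ : \bigcup_(v in S) _ = U); last first.
  by apply: eq_bigr => v vS; rewrite nSx.
by have [+ _] := leq_card_setU (a |: K) U; have [+ _] := leq_card_setU [set a] K; rewrite cards1; lia.
Qed.

(** With at most one earlier neighbour no common neighbours are involved and a minimum degree bound
    is enough; forests are placed this way too. *)
Lemma star_model_add_leaf (VH : finType) (eH : rel VH) (S : {set VH}) (x : VH)
    (VG : finType) (e : rel VG) (Z : {set VG}) (u : nat)
    (r : VH -> VG) (phi : VH -> {set VG}) :
  simple_graph eH -> simple_graph e ->
  star_model eH S e Z u r phi -> x \notin S -> #|nb eH S x| <= 1 ->
  u < #|Z| -> (forall w, w \in Z -> u <= #|nb e Z w|) ->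
  exists r' phi', star_model eH (x |: S) e Z u.+1 r' phi'.
Proof.
move=> sgH sg sm xS leb ltuZ degZ.
suff [a [aZ aU ea]] : exists a, [/\ a \in Z, a \notin \bigcup_(v in S) phi v
    & forall y, y \in nb eH S x -> e (r y) a].
  have := @star_model_add _ eH S set0 x _ e Z u 0 r phi a sgH sg sm xS aZ aU.
  rewrite cards0 addn0 addn1; apply; rewrite ?sub0set ?eqxx // => y; rewrite ?inE //.
  by move=> yS _; apply: ea; rewrite inE.
have [star dis adj card] := sm.
have [nb0|[y ynb]] := set_0Vmem (nb eH S x).
  have [|||a aZ aU] := @exists_fresh _ set0 Z (\bigcup_(v in S) phi v).
  - exact: sub0set.
  - by rewrite disjoints_subset sub0set.
  - by rewrite cards0; lia.
  by exists a; split=> // y; rewrite nb0 inE.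
have [yS _] : y \in S /\ eH x y by move: ynb; rewrite inE => /andP.
have [sZ ry _] := star y yS.
have ryU : r y \in \bigcup_(v in S) phi v by apply/bigcupP; exists y.
have [|||a] := @exists_fresh _ [set r y] (nb e Z (r y)) (\bigcup_(v in S) phi v).
- by rewrite sub1set.
- by rewrite disjoints1 inE; case: sg => _ ->; rewrite andbF.
- by rewrite cards1; have := degZ (r y) (subsetP sZ _ ry); lia.
rewrite inE => /andP[aZ eya] aU; exists a; split=> // z znb.
suff -> : z = y by [].
by apply/eqP; move: leb; apply: contraTT => nzy; rewrite -ltnNge; apply/card_gt1P; exists z, y.
Qed.

(** The property of the closed neighbourhood on which the placement runs; the successor avoids a
    truncated [q - 1]. *)
Definition rich (VG : finType) (e : rel VG) (Z : {set VG}) (q : nat) : Prop :=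
  [/\ q < #|Z|, forall w, w \in Z -> q <= #|nb e Z w|
    & forall w z, w \in Z -> z \in Z -> w != z ->
     q <= #|nb e Z w :&: nb e Z z|.+1].

(* A vertex with [b] neighbours already placed costs [max(1, b - 1)] vertices: it is
   put at a common neighbour of two of them, and each of the other [b - 2] is
   reached through one more vertex, which joins the new star. *)
Lemma star_model_step (VH : finType) (eH : rel VH) (S : {set VH}) (x : VH)
    (VG : finType) (e : rel VG) (Z : {set VG}) (u q : nat)
    (r : VH -> VG) (phi : VH -> {set VG}) :
  simple_graph eH -> simple_graph e -> rich e Z q ->
  star_model eH S e Z u r phi -> x \notin S ->
  u + maxn 1 #|nb eH S x|.-1 <= q.+1 ->
  exists r' phi',
    star_model eH (x |: S) e Z (u + maxn 1 #|nb eH S x|.-1) r' phi'.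
Proof.
move=> sgH sg [ltqZ degZ comZ] sm xS lequ.
have [le1|lt1] := leqP #|nb eH S x| 1.
  have -> : maxn 1 #|nb eH S x|.-1 = 1 by lia.
  rewrite addn1; apply: star_model_add_leaf sm xS _ _ _ => //; first by lia.
  by move=> w /degZ; lia.
have [star dis adj card] := sm.
have leuq : u <= q.
  by rewrite -ltnS -addn1; apply: leq_trans lequ; rewrite leq_add2l leq_maxl.
have [y [z [ynb znb nyz]]] := card_gt1P lt1.
set U := \bigcup_(v in S) phi v; rewrite -/U in card.
have [yS zS] : y \in S /\ z \in S by move: ynb znb; rewrite !inE => /andP[-> _] /andP[-> _].
have [sZ ry _] := star y yS; have [sZ' rz _] := star z zS.
have ryU : r y \in U by apply/bigcupP; exists y.
have rzU : r z \in U by apply/bigcupP; exists z.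
have nr : r y != r z.
  by apply: contraTneq rz => <-; rewrite (disjointFr (dis y z yS zS nyz) ry).
(* Both centres are used but are not their own common neighbours, so at most [q - 2] of the [q - 1]
   or more common neighbours are taken. *)
have [|||a] := @exists_fresh _ [set r y; r z] (nb e Z (r y) :&: nb e Z (r z)) U.
- by rewrite subUset !sub1set ryU.
- rewrite disjoints_subset; apply/subsetP=> w; rewrite !inE.
  by case: sg => _ irr; case/orP=> /eqP->; rewrite irr ?andbF.
- rewrite cards2 nr; move: (comZ _ _ (subsetP sZ _ ry) (subsetP sZ' _ rz) nr).
  by move: card leuq; clear; lia.
rewrite !inE => /andP[/andP[aZ eya] /andP[_ eza]] aU.
pose T := nb eH S x :\ y :\ z.
have cT : #|nb eH S x| = #|T|.+2.
  by rewrite (cardsD1 y) ynb (cardsD1 z (_ :\ y)) !inE eq_sym nyz; move: znb; rewrite inE => ->.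
have eqb : u + maxn 1 #|nb eH S x|.-1 = u + 1 + #|T|.
  by rewrite cT; clear; lia.
rewrite eqb; apply: (@star_model_add _ eH S T x _ e Z u q r phi a) => //.
- by apply/subsetP=> w; rewrite !inE => /and4P[].
- move=> w wnb; rewrite /T !in_setD1 wnb andbT negb_and !negbK.
  by case/orP=> /eqP->.
- move=> w; rewrite !inE => /and4P[nwz nwy wS _]; apply: comZ => //.
    by have [sw rw _] := star w wS; apply: (subsetP sw).
  by apply: contraNneq aU => ->; apply/bigcupP; exists w => //; have [] := star w wS.
- by move=> _; rewrite -eqb.
Qed.

Lemma star_model_set0 (VH : finType) (eH : rel VH) (VG : finType) (e : rel VG)
    (Z : {set VG}) (r : VH -> VG) :
  star_model eH set0 e Z 0 r (fun=> set0).
Proof.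
by split=> [v|v w|v w|]; rewrite ?inE // big_set0 cards0.
Qed.

(** * Graphs without tree components *)

(* A component is a tree iff it has fewer edges than vertices, and [dsum] counts
   every edge twice. *)
Definition no_tree_component (VH : finType) (eH : rel VH) (C : {set VH}) : Prop :=
  forall B : {set VH}, B \subset C -> closed_set eH B -> B != set0 ->
    2 * #|B| <= dsum eH B.

Lemma card_setD_ltn (T : finType) (C S S' : {set T}) :
  S \proper S' -> S' \subset C -> #|C :\: S'| < #|C :\: S|.
Proof.
move=> /properP[sSS' [x xS' xS]] sS'C; apply: proper_card; apply/properP; split.
  exact: setDS.
by exists x; rewrite !inE ?xS' ?xS // (subsetP sS'C).
Qed.

(* While the component being built is a tree, its root has cost one vertex more than
   its edges pay for; the first vertex closing a cycle pays this debt back. *)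
Lemma star_model_close_component (VH : finType) (eH : rel VH) (C S0 S : {set VH})
    (VG : finType) (e : rel VG) (Z : {set VG}) (u q : nat)
    (r : VH -> VG) (phi : VH -> {set VG}) :
  simple_graph eH -> simple_graph e -> rich e Z q ->
  closed_set eH C -> no_tree_component eH C -> dsum eH C <= 2 * q ->
  closed_set eH S0 -> S0 \proper S -> S \subset C ->
  dsum eH S + 2 = dsum eH S0 + 2 * #|S :\: S0| ->
  star_model eH S e Z u r phi -> 2 * u <= dsum eH S + 2 ->
  exists (S' : {set VH}) u' r' phi', [/\ S0 \proper S', S' \subset C,
    star_model eH S' e Z u' r' phi' & 2 * u' <= dsum eH S'].
Proof.
move=> sgH sg richZ cC ntC leC cS0.
have [n] := ubnP #|C :\: S|; elim: n S u r phi => // n IH S u r phi ltn pS0S sSC tree sm leu.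
have sS0S := proper_sub pS0S.
(* By the tree condition [S :\: S0] has fewer edges than vertices, so it cannot be closed, and
   neither can [S]. *)
have [cS|ncS] := boolP (closed_set eH S).
  have cD : closed_set eH (S :\: S0) by apply: closed_setD => //; case: sgH.
  have nD : S :\: S0 != set0.
    by rewrite setD_eq0; case/properP: pS0S => _ [x xS xS0]; apply/subsetPn; exists x.
  move: (ntC _ (subset_trans (subsetDl _ _) sSC) cD nD) tree.
  by move: (dsum_closedD (proj1 sgH) cS0 sS0S); clear; lia.
have [x [xC xS b0]] := exists_boundary (proj1 sgH) cC sSC ncS.
have sxS : x |: S \subset C by rewrite subUset sub1set xC.
have pSx : S \proper x |: S.
  by apply/properP; split; [apply: subsetUr|exists x; rewrite ?setU11].
have eqd := dsumU1 sgH xS; have led := dsum_sub eH sxS.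
have [|r' [phi' sm']] := star_model_step sgH sg richZ sm xS.
  by move: leu leC led eqd b0; clear; lia.
have [b1|b2] := leqP #|nb eH S x| 1; last first.
  exists (x |: S), (u + maxn 1 #|nb eH S x|.-1), r', phi'; split=> //.
    exact: proper_sub_trans pS0S (subsetUr _ _).
  by move: leu eqd b2; clear; lia.
apply: (IH (x |: S) (u + maxn 1 #|nb eH S x|.-1) r' phi') => //.
- exact: leq_trans (card_setD_ltn pSx sxS) _.
- exact: proper_sub_trans pS0S (subsetUr _ _).
- have -> : (x |: S) :\: S0 = x |: (S :\: S0).
    apply/setP=> w; rewrite !inE; have [->|//] := eqVneq w x.
    by rewrite (contra (subsetP sS0S x) xS).
  rewrite cardsU1 !inE (negPf xS) andbF; move: tree eqd b0 b1; clear; lia.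
- by move: leu eqd b0 b1; clear; lia.
Qed.

Lemma star_model_no_tree (VH : finType) (eH : rel VH) (C : {set VH})
    (VG : finType) (e : rel VG) (Z : {set VG}) (q : nat) :
  simple_graph eH -> simple_graph e -> rich e Z q ->
  closed_set eH C -> no_tree_component eH C -> dsum eH C <= 2 * q ->
  exists r phi, star_model eH C e Z q r phi.
Proof.
move=> sgH sg richZ cC ntC leC; have z0 : VG by case: (pickP (mem Z)) => [//|Z0]; case: richZ => + _ _; rewrite (eq_card0 Z0).
(* Invariant: at most as many vertices are used as there are edges inside [S], hence at most [q]
   when [S] is all of [C]. *)
suff grow : forall n S u r phi, #|C :\: S| < n -> S \subset C ->
    star_model eH S e Z u r phi -> 2 * u <= dsum eH S ->
    exists r phi, star_model eH C e Z q r phi.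
  apply: (grow #|C|.+1 set0 0 (fun=> z0) _ _ (sub0set _) (star_model_set0 _ _ _ _)) => //.
  by rewrite setD0.
elim=> // n IH S u r phi ltn sSC sm leu.
have [eqSC|nSC] := eqVneq S C.
  exists r, phi; case: sm => star dis adj card; rewrite eqSC in star dis adj card leu.
  by split=> //; move: card leu leC; clear; lia.
have pSC : S \proper C by rewrite properEneq nSC.
suff [S' [u' [r' [phi' [pSS' sS'C sm' leu']]]]] : exists (S' : {set VH}) u' r' phi',
    [/\ S \proper S', S' \subset C, star_model eH S' e Z u' r' phi'
      & 2 * u' <= dsum eH S'].
  apply: (IH S' u' r' phi') => //; exact: leq_trans (card_setD_ltn pSS' sS'C) _.
have led := dsum_sub eH sSC.
have pU1 x : x \notin S -> S \proper x |: S.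
  by move=> xS; apply/properP; split; [apply: subsetUr|exists x; rewrite ?setU11].
have [cS|ncS] := boolP (closed_set eH S); last first.
  have [x [xC xS b0]] := exists_boundary (proj1 sgH) cC sSC ncS.
  have sxS : x |: S \subset C by rewrite subUset sub1set xC.
  have eqd := dsumU1 sgH xS; have ledx := dsum_sub eH sxS.
  have [|r' [phi' sm']] := star_model_step sgH sg richZ sm xS.
    by move: leu leC ledx eqd b0; clear; lia.
  exists (x |: S), (u + maxn 1 #|nb eH S x|.-1), r', phi'; split; rewrite ?pU1 //.
  by move: leu eqd b0; clear; lia.
(* Here [S] is a union of components: [x] becomes the root of a new one, at a debt of one vertex
   that [star_model_close_component] settles. *)
have [_ [x xC xS]] := properP pSC.
have sxS : x |: S \subset C by rewrite subUset sub1set xC.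
have b0 : #|nb eH S x| = 0.
  apply: eq_card0 => w; rewrite inE; apply/negP=> /andP[wS exw].
  by case/negP: xS; apply: (closed_setP _ _ cS w x wS); case: sgH => ->.
have eqd := dsumU1 sgH xS.
have [|r' [phi' sm']] := star_model_step sgH sg richZ sm xS.
  by rewrite b0; move: leu leC led; clear; lia.
apply: (star_model_close_component sgH sg richZ cC ntC leC cS _ _ _ sm'); rewrite ?pU1 //.
  have -> : (x |: S) :\: S = [set x].
    by apply/setP=> w; rewrite !inE; have [->|] := eqVneq w x; rewrite ?xS //= andNb.
  by rewrite cards1 eqd b0; clear; lia.
by rewrite eqd b0; move: leu; clear; lia.
Qed.

(** * Forests and the removal of tree components *)

(** Equivalent to being a forest, in the form used by a greedy placement. *)
Definition one_degenerate (V : finType) (e : rel V) (F : {set V}) : Prop :=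
  forall X : {set V}, X \subset F -> X != set0 -> exists2 x, x \in X & #|nb e X x| <= 1.

Lemma star_model_forest (VH : finType) (eH : rel VH) (F : {set VH})
    (VG : finType) (e : rel VG) (Z : {set VG}) :
  simple_graph eH -> simple_graph e -> one_degenerate eH F -> Z != set0 ->
  (forall w, w \in Z -> #|F| <= #|nb e Z w|) ->
  exists r phi, star_model eH F e Z #|F| r phi.
Proof.
move=> sgH sg dF /set0Pn[z0 z0Z] degZ.
have ltFZ : #|F| < #|Z| by apply: leq_ltn_trans (degZ z0 z0Z) (nb_ltn _ z0Z); case: sg.
suff main n : forall S : {set VH}, #|S| = n -> S \subset F -> exists r phi, star_model eH S e Z n r phi.
  exact: main.
elim: n => [|n IH] S cS sSF.
  by exists (fun=> z0), (fun=> set0); rewrite (cards0_eq cS); apply: star_model_set0.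
have S0 : S != set0 by rewrite -card_gt0 cS.
have [x xS b1] := dF S sSF S0.
have cS' : #|S :\ x| = n by have := cardsD1 x S; rewrite xS cS => -[].
have [r [phi sm]] := IH _ cS' (subset_trans (subD1set _ _) sSF).
have lenF : n < #|F| by rewrite -cS subset_leq_card.
have := star_model_add_leaf sgH sg sm.
move=> /(_ x); rewrite setD1K // => -[]; rewrite ?inE ?eqxx //.
- by apply: leq_trans b1; apply: subset_leq_card; apply/subsetP=> w; rewrite !inE => /andP[/andP[_ ->]].
- exact: ltn_trans lenF ltFZ.
- by move=> w /degZ; apply: leq_trans; apply: ltnW.
- by move=> r' [phi' sm']; exists r', phi'.
Qed.

(** Deleting a vertex of degree below [k] lowers [dsum] by less than [2 * k], so the density
    hypothesis survives. *)
Lemma min_degree_subgraph (V : finType) (e : rel V) (X : {set V}) (k : nat) :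
  simple_graph e -> X != set0 -> 2 * k * #|X| <= dsum e X ->
  exists Y : {set V}, [/\ Y \subset X, Y != set0 & forall w, w \in Y -> k <= #|nb e Y w|].
Proof.
move=> sg; have [n] := ubnP #|X|; elim: n X => // n IH X ltn X0 le.
have [/forall_inP H|] := boolP [forall w in X, k <= #|nb e X w|]; first by exists X.
rewrite negb_forall_in => /exists_inP[w wX]; rewrite -ltnNge => ltw.
have cX := cardsD1 w X; rewrite wX in cX; have dX := dsum_del sg wX.
have [|||Y [sYX Y0 degY]] := IH (X :\ w).
- by move: ltn cX; clear; lia.
(* The last vertex is never deleted: on one vertex [dsum] is 0, which forces [k = 0]. *)
- rewrite -card_gt0 lt0n; apply/eqP=> c0.
  have [_ irr] := sg; have := dsum_bound X irr.
  by move: le cX ltw; rewrite c0; clear; case: #|X| => [|[|m]]; lia.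
- by move: le cX dX ltw; clear; lia.
by exists Y; split=> //; apply: subset_trans sYX (subD1set _ _).
Qed.

(** [F] collects the tree components: a minimal nonempty closed set with fewer edges than vertices
    is connected, hence a tree, and is split off repeatedly. *)
Lemma split_trees (V : finType) (e : rel V) (D : {set V}) :
  simple_graph e -> closed_set e D ->
  exists F : {set V}, [/\ F \subset D, closed_set e F, one_degenerate e F
    & no_tree_component e (D :\: F)].
Proof.
move=> sg; have [sym irr] := sg; have [n] := ubnP #|D|; elim: n D => // n IH D ltn cD.
pose bad (B : {set V}) := [&& B \subset D, closed_set e B, B != set0 & dsum e B < 2 * #|B|].
have [/existsP[B1 badB1]|] := boolP [exists B, bad B]; last first.
  rewrite negb_exists => /forallP nobad; exists set0; split; rewrite ?sub0set //.
  - by apply/closed_setP=> u v; rewrite inE.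
  - by move=> X; rewrite subset0 => /eqP->; rewrite eqxx.
  rewrite setD0 => B sB cB B0; rewrite leqNgt; apply: contra (nobad B) => ltB.
  by rewrite /bad sB cB B0.
have [B /and4P[sBD cB B0 ltB] minB] := @arg_minnP _ B1 bad (fun B => #|B|) badB1.
(* If [B] split into two closed parts, one of them would have fewer edges than vertices, against
   minimality. *)
have conn (A : {set V}) : A \subset B -> closed_set e A -> A != set0 -> A = B.
  move=> sAB cA A0; apply/eqP; rewrite eqEsubset sAB /= -setD_eq0; apply: contraLR ltB => D0.
  have cBA := closed_setD sym cB cA.
  have nbad (A' : {set V}) : A' \proper B -> closed_set e A' -> A' != set0 -> 2 * #|A'| <= dsum e A'.
    move=> pA cA' A'0; rewrite leqNgt; apply/negP=> ltA.
    have := minB A'; rewrite /bad cA' A'0 ltA (subset_trans (proper_sub pA)) //= => /(_ isT).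
    by rewrite leqNgt proper_card.
  have [x xBA] := set0Pn _ D0; have [y yA] := set0Pn _ A0.
  have pA : A \proper B.
    by apply/properP; split=> //; exists x; move: xBA; rewrite inE => /andP[].
  have pBA : B :\: A \proper B.
    apply/properP; split; first exact: subsetDl.
    by exists y; rewrite ?inE ?yA // (subsetP sAB).
  move: (nbad _ pA cA A0) (nbad _ pBA cBA D0) (dsum_closedD sym cA sAB) (cardsD B A).
  rewrite (setIidPr sAB) -leqNgt; move: (subset_leq_card sAB); clear; lia.
(* A set with all inner degrees at least 2 has at least as many edges as vertices. Growing it to [B]
   by boundary vertices adds at least one edge per vertex, so the same would hold for [B]. *)
have dB : one_degenerate e B.
  move=> X sXB X0.
  have [/existsP[x /andP[xX b1]]|] := boolP [exists x, (x \in X) && (#|nb e X x| <= 1)].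
    by exists x.
  rewrite negb_exists => /forallP nX; exfalso; move: ltB; apply/negP; rewrite -leqNgt.
  have X2 : 2 * #|X| <= dsum e X.
    rewrite mulnC -sum_nat_const; apply: leq_sum => u uX.
    by have := nX u; rewrite uX /= -ltnNge.
  have [m] := ubnP #|B :\: X|; elim: m X sXB X0 {nX} X2 => // m IHm X sXB X0 X2 ltm.
  have [cX|ncX] := boolP (closed_set e X); first by rewrite -(conn X).
  have [x [xB xX b0]] := exists_boundary sym cB sXB ncX.
  have sxB : x |: X \subset B by rewrite subUset sub1set xB.
  have pX : X \proper x |: X.
    by apply/properP; split; [apply: subsetUr|exists x; rewrite ?setU11].
  apply: (IHm (x |: X)) => //.
  - by apply/set0Pn; exists x; apply: setU11.
  - by rewrite (dsumU1 sg xX) cardsU1 xX; move: X2 b0; clear; lia.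
  - exact: leq_trans (card_setD_ltn pX sxB) _.
have [||F [sF cF dF ntF]] := IH (D :\: B).
- rewrite -ltnS; apply: leq_trans ltn; rewrite ltnS; apply: proper_card; apply/properP; split; first exact: subsetDl.
  by have [x xB] := set0Pn _ B0; exists x; rewrite ?inE ?xB // (subsetP sBD).
- exact: closed_setD.
exists (B :|: F); split.
- by rewrite subUset sBD (subset_trans sF) ?subsetDl.
- apply/closed_setP=> u v; rewrite !inE => /orP[uB|uF] euv.
    by rewrite (closed_setP _ _ cB u v).
  by rewrite (closed_setP _ _ cF u v) ?orbT.
- move=> X sX X0; have [XB0|XB0] := eqVneq (X :&: B) set0.
    apply: dF => //; apply/subsetP=> x xX; have := subsetP sX x xX; rewrite inE.
    by case/orP=> // xB; have := in_set0 x; rewrite -XB0 inE xX xB.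
  have [x] := dB (X :&: B) (subsetIr _ _) XB0; rewrite inE => /andP[xX xB] b1.
  exists x => //; apply: leq_trans b1; apply: subset_leq_card; apply/subsetP=> w.
  by rewrite !inE => /andP[-> exw]; rewrite exw (closed_setP _ _ cB x w).
by rewrite -setDDl.
Qed.

(** * Minimal dense graphs and closed neighbourhoods *)

(** [L n w] is a density condition on [n] vertices with degree sum [w]. Steps that keep it are
    repeated until none is left, and models lift back. As [L] is monotone in [w], it may be tested
    at a lower bound for the new degree sum. *)
Lemma minor_descent (VH : finType) (eH : rel VH) (A : {set VH})
    (VG : finType) (L : nat -> nat -> bool) :
  (forall n w w', w <= w' -> L n w -> L n w') ->
  (forall (e : rel VG) (X : {set VG}), simple_graph e -> L #|X| (dsum e X) ->
    (forall x y, x \in X -> y \in X -> e x y ->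
       ~~ L #|X|.-1 (dsum e X - (2 + 2 * #|nb e X x :&: nb e X y|))) ->
    (forall v, v \in X -> ~~ L #|X|.-1 (dsum e X - 2 * #|nb e X v|)) ->
    model eH A e X) ->
  forall (e : rel VG) (X : {set VG}), simple_graph e -> L #|X| (dsum e X) ->
    model eH A e X.
Proof.
move=> monoL base e X; have [n] := ubnP #|X|; elim: n e X => // n IH e X ltn sg LX.
have ltD1 y : y \in X -> #|X :\ y| < n /\ #|X :\ y| = #|X|.-1.
  by move=> yX; move: ltn; rewrite (cardsD1 y X) yX.
have [/existsP[x /existsP[y /and4P[xX yX exy Lc]]]|nc] := boolP [exists x, exists y,
    [&& x \in X, y \in X, e x y &
      L #|X|.-1 (dsum e X - (2 + 2 * #|nb e X x :&: nb e X y|))]].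
  apply: (model_contract sg yX exy); have [lty eqy] := ltD1 y yX.
  apply: IH => //; first exact: contract_simple.
  rewrite eqy; apply: monoL Lc; rewrite leq_subLR.
  by have := dsum_contract sg xX yX exy; clear; lia.
have [/exists_inP[v vX Lv]|nd] := boolP [exists v in X, L #|X|.-1 (dsum e X - 2 * #|nb e X v|)].
  apply: (model_sub (subD1set X v)); have [ltv eqv] := ltD1 v vX.
  apply: IH => //; rewrite eqv; apply: monoL Lv; rewrite leq_subLR.
  by have := dsum_del sg vX; clear; lia.
apply: base => // [x y xX yX exy|v vX].
  apply: contra nc => Lc; apply/existsP; exists x; apply/existsP; exists y.
  by rewrite xX yX exy.
by apply: contra nd => Lv; apply/exists_inP; exists v.
Qed.

(** Either way, twice the degree of [u] in the closed neighbourhood is at least the loss allowed for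
    deleting [v] or for contracting [vu], so minimality bounds it from below. *)
Lemma closed_nbhd_degree (V : finType) (e : rel V) (X : {set V}) (v u : V) :
  simple_graph e -> v \in X -> u \in v |: nb e X v ->
  #|nb e X v| <= #|nb e (v |: nb e X v) u| \/
  [/\ u \in X, e v u &
    #|nb e X v :&: nb e X u| < #|nb e (v |: nb e X v) u|].
Proof.
move=> [sym irr] vX /setU1P[->|unb].
  left; apply: subset_leq_card; apply/subsetP=> w wv; rewrite inE setU1r //.
  by move: wv; rewrite inE => /andP[].
right; move: (unb); rewrite inE => /andP[uX evu]; split=> //.
have -> : #|nb e X v :&: nb e X u|.+1 = #|v |: (nb e X v :&: nb e X u)|.
  by rewrite cardsU1 !inE irr !andbF.
apply: subset_leq_card; apply/subsetP=> w /setU1P[->|].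
  by rewrite !inE eqxx sym evu.
by rewrite !inE => /andP[/andP[-> ->] /andP[_ ->]]; rewrite orbT.
Qed.

(** Deleting a vertex of minimum degree does not lower the ratio of [dsum] to [n (n - 1)], where
    [n = #|X|]. *)
Lemma dense_subset (V : finType) (e : rel V) (X : {set V}) (k : nat) :
  simple_graph e -> k <= #|X| -> #|X| * #|X|.-1 <= 2 * dsum e X ->
  exists Y : {set V}, [/\ Y \subset X, #|Y| = k & k * k.-1 <= 2 * dsum e Y].
Proof.
move=> sg; have [n] := ubnP #|X|; elim: n X => // n IH X ltn lek leX.
have [eqk|nek] := eqVneq #|X| k; first by exists X; rewrite -{2 3}eqk.
have X0 : X != set0 by rewrite -card_gt0; move: lek nek; clear; lia.
have [v vX vmin] := exists_min_degree e X0.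
have cX := cardsD1 v X; rewrite vX in cX; have dX := dsum_del sg vX.
have [|||Y [sYX cY leY]] := IH (X :\ v).
- by move: ltn cX; clear; lia.
- by move: lek nek cX; clear; lia.
- rewrite -(leq_pmul2l (m := #|X|)) ?card_gt0 //.
  move: vmin leX dX; rewrite cX add1n /=; clear; move: (dsum _ _) (dsum _ _) #|_| #|_|.
  by move=> a b c d; nia.
by exists Y; split=> //; apply: subset_trans sYX (subD1set _ _).
Qed.

Lemma common_nb (V : finType) (e : rel V) (Z : {set V}) (u w : V) :
  #|nb e Z u| + #|nb e Z w| <= #|Z| + #|nb e Z u :&: nb e Z w|.
Proof.
rewrite -cardsUI leq_add2r; apply: subset_leq_card.
by apply/subsetP=> a; rewrite !inE => /orP[]/andP[].
Qed.

Lemma model_isolated (VH : finType) (eH : rel VH) (I : {set VH})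
    (VG : finType) (e : rel VG) (X : {set VG}) :
  (forall u v, u \in I -> ~~ eH u v) -> #|I| <= #|X| -> model eH I e X.
Proof.
move=> iso leIX; have [I0|/set0Pn[v0 v0I]] := eqVneq I set0.
  by exists (fun=> set0); split=> [v|v|u v|u v]; rewrite I0 inE.
have [x0 x0X] : exists x0, x0 \in X.
  by apply/card_gt0P; apply: leq_trans leIX; apply/card_gt0P; exists v0.
pose f v := nth x0 (enum X) (index v (enum I)).
have idx v : v \in I -> index v (enum I) < size (enum X).
  by move=> vI; rewrite -cardE; apply: leq_trans leIX; rewrite cardE index_mem mem_enum.
exists (fun v => [set f v]); split=> [v vI|v vI|u v uI vI|u v uI _ euv].
- by rewrite sub1set -mem_enum mem_nth ?idx.
- split; first by apply/set0Pn; exists (f v); rewrite inE.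
  by move=> a b; rewrite !inE => /eqP-> /eqP->; apply: connect0.
- apply: contraNT; rewrite disjoints1 negbK inE => /eqP/eqP.
  rewrite nth_uniq ?idx ?enum_uniq // => /eqP eqi.
  by rewrite -(nth_index u (s := enum I) (x := u)) ?mem_enum // eqi nth_index ?mem_enum.
- by have := iso u v uI; rewrite euv.
Qed.

Lemma dsum_le_num_edges (V : finType) (e : rel V) :
  dsum e [set: V] <= 2 * num_edges e.
Proof.
pose ends (p : V * V) : {set V} := [set p.1; p.2].
have -> : dsum e [set: V] = \sum_(p : V * V | e p.1 p.2) 1.
  rewrite /dsum (eq_bigr (fun u => \sum_(w | e u w) 1)) => [|u _].
    by rewrite pair_big_dep; apply: eq_bigl => p; rewrite inE.
  by rewrite sum1dep_card; apply: eq_card => w; rewrite !inE.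
rewrite (partition_big ends (mem (edge_set e))) /=; last first.
  case=> x y /= exy; rewrite inE; apply/existsP; exists x; apply/existsP; exists y.
  by rewrite exy eqxx.
rewrite mulnC -sum_nat_const; apply: leq_sum => A.
rewrite inE => /existsP[x /existsP[y /andP[exy /eqP->]]].
rewrite sum1dep_card; apply: (@leq_trans #|[set (x, y); (y, x)]|); last first.
  by rewrite cards2 ltnS leq_b1.
apply: subset_leq_card; apply/subsetP=> -[a b]; rewrite !inE /= => /andP[_ /eqP]; rewrite /ends /= => eqs.
have : a \in [set x; y] by rewrite -eqs !inE eqxx.
have : b \in [set x; y] by rewrite -eqs !inE eqxx orbT.
have : x \in [set a; b] by rewrite eqs !inE eqxx.
have : y \in [set a; b] by rewrite eqs !inE eqxx orbT.
rewrite !inE !xpair_eqE.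
by do 4! [case/orP=> /eqP ?]; subst; rewrite ?eqxx ?orbT.
Qed.

(** * The density threshold *)

(* The solution [g] of [(n - 1) (g(n) - g(n-1)) = q - 1] with [g(q) = q]: a graph of
   average degree [g(n)] on [n] vertices all of whose contractions have average
   degree below [g(n-1)] has a [rich] closed neighbourhood. *)
Definition threshold (q n : nat) : rat :=
  (q%:R + (q%:R - 1) * \sum_(q <= k < n) k%:R^-1)%R.

Lemma thresholdS (q n : nat) : q <= n ->
  threshold q n.+1 = (threshold q n + (q%:R - 1) / n%:R)%R.
Proof. by move=> leqn; rewrite /threshold big_nat_recr //= mulrDr addrA. Qed.

Lemma threshold_ge (q n : nat) : 0 < q -> (q%:R <= threshold q n)%R.
Proof.
move=> q0; rewrite lerDl mulr_ge0 ?subr_ge0 ?ler1n // sumr_ge0 // => k _.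
by rewrite invr_ge0 ler0n.
Qed.

Lemma threshold_mono (q m n : nat) : 0 < q -> q <= m -> m <= n ->
  (threshold q m <= threshold q n)%R.
Proof.
move=> q0 leqm; elim: n => [|n IH]; first by rewrite leqn0 => /eqP->.
rewrite leq_eqVlt => /orP[/eqP-> //|]; rewrite ltnS => lemn.
apply: le_trans (IH lemn) _; rewrite thresholdS ?(leq_trans leqm) //.
by rewrite lerDl divr_ge0 ?subr_ge0 ?ler1n ?ler0n.
Qed.

(** The sum tends to [ln 6 < 2]. Passing from [p] to [p + 1] drops [1/p] and adds the six terms
    [1/(6p+1)] to [1/(6p+6)]; the correction [1/(2q)] carries the induction. *)
Lemma harmonic_block (q : nat) : 0 < q ->
  (\sum_(q <= k < 6 * q + 1) k%:R^-1 <= 2%:R + (2 * q%:R)^-1 :> rat)%R.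
Proof.
case: q => // q _; elim: q => [|q IH].
  have -> : 6 * 1 + 1 = 7 by [].
  do 6 (rewrite big_ltn; last by []).
  rewrite big_geq; last by [].
  rewrite -subr_ge0 (_ : _ - _ = 1 / 20)%R; last by field.
  by rewrite divr_ge0 ?ler0n.
move: IH; set p := q.+1; rewrite big_ltn; last by clear; lia.
have -> : (\sum_(p.+1 <= k < 6 * p.+1 + 1) k%:R^-1 =
    \sum_(p.+1 <= k < 6 * p + 1) k%:R^-1 + \sum_(1 <= j < 7) (6 * p + j)%:R^-1 :> rat)%R.
  rewrite (@big_cat_nat _ _ _ (6 * p + 1)) /=; [|by clear; lia|by clear; lia].
  congr (_ + _)%R; rewrite -[6 * p + 1]addnC (_ : 6 * p.+1 + 1 = 7 + 6 * p); last by clear; lia.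
  by rewrite big_addn addnK; apply: eq_bigr => j _; rewrite addnC.
have p0 : (0 < p%:R :> rat)%R by rewrite ltr0n.
(* Convexity: [1/(6p+j)] lies below the chord between [j = 0] and [j = 6]. *)
have step j : j <= 6 -> ((6 * p + j)%:R^-1 <=
    (6 * p%:R)^-1 - j%:R / (36 * p%:R * (p%:R + 1)) :> rat)%R.
  move=> lej; have pos : (0 < (6 * p + j)%:R :> rat)%R by rewrite ltr0n.
  rewrite -[leLHS]mul1r ler_pdivrMr // natrD natrM -subr_ge0.
  have -> : (((6 * p%:R)^-1 - j%:R / (36 * p%:R * (p%:R + 1))) * (6 * p%:R + j%:R) - 1
     = j%:R * (6 - j%:R) / (36 * p%:R * (p%:R + 1)) :> rat)%R.
    by field; rewrite ?(gt_eqF p0) ?gt_eqF //; lra.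
  by rewrite divr_ge0 ?mulr_ge0 ?subr_ge0 ?(ler_nat _ _ 6) //; lra.
have : (\sum_(1 <= j < 7) (6 * p + j)%:R^-1 <=
    \sum_(1 <= j < 7) ((6 * p%:R)^-1 - j%:R / (36 * p%:R * (p%:R + 1))) :> rat)%R.
  by rewrite big_nat [leRHS]big_nat; apply: ler_sum => j /andP[_ ltj]; apply: step.
have -> : (\sum_(1 <= j < 7) ((6 * p%:R)^-1 - j%:R / (36 * p%:R * (p%:R + 1)))
    = p%:R^-1 - 7 / (12 * p%:R * (p%:R + 1)) :> rat)%R.
  do 6 (rewrite big_ltn; last by []).
  rewrite big_geq; last by [].
  by field; rewrite ?(gt_eqF p0) ?gt_eqF //; lra.
(* Over [p (p + 1)], the chords gain [7/12] while the correction shrinks by [6/12]. *)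
have : (0 <= (2 * p.+1%:R)^-1 - (2 * p%:R)^-1 + 7 / (12 * p%:R * (p%:R + 1)) :> rat)%R.
  rewrite -[(p.+1%:R)%R]natr1.
  rewrite (_ : _ + _ = (12 * p%:R * (p%:R + 1))^-1)%R.
    by rewrite invr_ge0 !mulr_ge0 //; lra.
  by field; rewrite ?(gt_eqF p0) ?gt_eqF //; lra.
have lin (a b c d i s : rat) : (0 <= d - c + a -> s <= i - a ->
    i + b <= 2 + c -> b + s <= 2 + d)%R by lra.
exact: lin.
Qed.

Lemma threshold_6q (q n : nat) : 0 < q -> q <= n -> n <= 6 * q + 1 ->
  (threshold q n <= 3 * q%:R)%R.
Proof.
move=> q0 leqn len; apply: le_trans (threshold_mono q0 leqn len) _.
have q1 : (1 <= q%:R :> rat)%R by rewrite ler1n.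
have : ((q%:R - 1) * \sum_(q <= k < 6 * q + 1) k%:R^-1 <=
    (q%:R - 1) * (2%:R + (2 * q%:R)^-1) :> rat)%R.
  by rewrite ler_wpM2l ?subr_ge0 // harmonic_block.
have : (q%:R * (2 * q%:R)^-1 = 1 / 2 :> rat)%R by field; rewrite gt_eqF //; lra.
have : (0 <= (2 * q%:R)^-1 :> rat)%R by rewrite invr_ge0; lra.
rewrite /threshold; move: q1; set t := (\sum_(_ <= _ < _) _)%R; set c := ((2 * _)^-1)%R.
have lin (x b a : rat) : (1 <= x -> 0 <= a -> x * a = 1 / 2 ->
   b <= (x - 1) * (2 + a) -> x + b <= 3 * x)%R by nra.
exact: lin.
Qed.

(** * Models in graphs above the threshold *)

Lemma model_dense (VH : finType) (eH : rel VH) (C : {set VH})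
    (VG : finType) (e : rel VG) (X : {set VG}) (q : nat) :
  simple_graph eH -> simple_graph e -> 0 < q ->
  closed_set eH C -> no_tree_component eH C -> dsum eH C <= 2 * q ->
  q <= #|X| -> (#|X|%:R * threshold q #|X| <= (dsum e X)%:R)%R ->
  model eH C e X.
Proof.
move=> sgH sg q0 cC ntC leC leqX leX.
pose L n w := (q <= n) && (n%:R * threshold q n <= w%:R)%R.
apply: (@minor_descent _ eH C VG L) => //; last by rewrite /L leqX.
  move=> n w w' lew /andP[leqn le1]; rewrite /L leqn; apply: le_trans le1 _.
  by rewrite ler_nat.
move=> {sg leqX leX} {}e {}X sg /andP[leqX leX] noC noD.
have [sym irr] := sg; have bnd := dsum_bound X irr.
have q1 : (1 <= q%:R :> rat)%R by rewrite ler1n.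
have X0 : X != set0 by rewrite -card_gt0; apply: leq_trans leqX.
have [v vX vmin] := exists_min_degree e X0.
set w := dsum e X in leX noC noD bnd vmin.
(* On [q] vertices the degree sum is at most [q (q - 1)], below [q] times the threshold. *)
move: leqX; rewrite leq_eqVlt => /orP[/eqP eqq|].
  have : (w%:R < #|X|%:R * threshold q #|X|)%R.
    apply: (@lt_le_trans _ _ (#|X|%:R * q%:R)%R).
      by rewrite -natrM ltr_nat -eqq; apply: leq_ltn_trans bnd _; rewrite -eqq; move: q0; clear; nia.
    by rewrite ler_wpM2l ?ler0n ?threshold_ge.
  by rewrite ltNge leX.
case eqn : #|X| => [//|m]; rewrite ltnS => leqm; rewrite eqn /= in leX noC noD bnd vmin.
rewrite thresholdS // in leX.
have G0 := threshold_ge m q0; set G := threshold q m in leX G0.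
have m0 : (0 < m%:R :> rat)%R by rewrite ltr0n; apply: leq_trans leqm.
have hm : (m%:R * ((q%:R - 1) / m%:R) = q%:R - 1 :> rat)%R.
  by rewrite mulrCA divff ?mulr1 ?gt_eqF.
have h0 : (0 <= (q%:R - 1) / m%:R :> rat)%R by rewrite divr_ge0 ?subr_ge0 // ltW.
set h := ((q%:R - 1) / m%:R)%R in leX hm h0.
(* By minimality each step loses more than [w - m G], where [G] and [G + h] are the thresholds at
   [m] and [m + 1]. *)
have loss a : ~~ L m (w - a) -> (w%:R - m%:R * G < a%:R)%R.
  rewrite /L leqm /= -ltNge => lt1; rewrite ltrBlDl -ltrBlDr.
  apply: le_lt_trans lt1; rewrite lerBlDr -natrD ler_nat; clear; lia.
pose Z := v |: nb e X v.
have degZ u : u \in Z -> (w%:R - m%:R * G < 2 * #|nb e Z u|%:R)%R.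
  move=> uZ; rewrite -natrM; have [le|[uX evu lt]] := closed_nbhd_degree sg vX uZ.
    by apply: lt_le_trans (loss _ (noD v vX)) _; rewrite ler_nat leq_mul2l le.
  apply: lt_le_trans (loss _ (noC v u vX uX evu)) _.
  by rewrite ler_nat -mulnS leq_mul2l lt.
have cZ : #|Z| = #|nb e X v|.+1 by rewrite cardsU1 inE irr andbF.
(* From [w >= (m + 1) (G + h)], [m h = q - 1] and [G >= q] follows [w - m G >= 2 q - 1]. *)
have q_deg u : u \in Z -> q <= #|nb e Z u|.
  have lin (x y z d a b : rat) : (z - y * a < 2 * d -> (y + 1) * (a + b) <= z ->
      x <= a -> y * b = x - 1 -> 0 <= b -> 2 * x < 2 * d + 1)%R by nra.
  move=> /degZ lt; rewrite -(leq_pmul2l (m := 2)) // -ltnS -(ltr_nat rat).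
  rewrite -[X in (_ < X)%R]natr1 !natrM; apply: lin lt _ G0 hm h0.
  by rewrite natr1.
apply: (@model_sub _ _ _ _ _ Z).
  by rewrite subUset sub1set vX; apply/subsetP=> u; rewrite inE => /andP[].
suff richZ : rich e Z q.
  have [r [phi sm]] := star_model_no_tree sgH sg richZ cC ntC leC.
  have [Y [sYZ _ mY]] := star_model_model sym sm; exact: model_sub sYZ mY.
split=> [|//|a b aZ bZ nab].
  exact: leq_ltn_trans (q_deg v (setU11 _ _)) (nb_ltn irr (setU11 _ _)).
(* If [v] has degree [D], there are more than [w - m G - (D + 1)] common neighbours in [Z]. As
   [D <= w / (m + 1)], this bound is at least [m h - 1 = q - 2]. *)
have := common_nb e Z a b; rewrite cZ -(ler_nat rat) !natrD -natr1 => com.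
have vmin' : ((m%:R + 1) * #|nb e X v|%:R <= w%:R :> rat)%R.
  by rewrite natr1 -natrM ler_nat.
have leX' : ((m%:R + 1) * (G + h) <= w%:R)%R by rewrite natr1.
have lin (x y z d d' g k D c : rat) : (z - y * g < 2 * d -> z - y * g < 2 * d' ->
    (y + 1) * D <= z -> (y + 1) * (g + k) <= z -> d + d' <= D + 1 + c ->
    0 < y -> y * k = x - 1 -> x < c + 1 + 1)%R.
  move=> h1 h2 h3 h4 h5 y0 hk.
  have lt : (z - y * g < D + 1 + c)%R by lra.
  have le : ((y + 1) * (y * k) <= (y + 1) * (z - y * g) - z)%R by nra.
  have : ((y + 1) * (x - 1) < (y + 1) * (1 + c))%R by rewrite -hk; nra.
  by rewrite ltr_pM2l; lra.
rewrite -ltnS -(ltr_nat rat) -!natr1.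
exact: lin (degZ a aZ) (degZ b bZ) vmin' leX' com m0 hm.
Qed.

(** * From large average degree to a small dense part *)

Lemma model_sparse (VH : finType) (eH : rel VH) (C I : {set VH})
    (VG : finType) (e : rel VG) (X : {set VG}) (q : nat) :
  simple_graph eH -> simple_graph e -> 0 < q ->
  closed_set eH C -> no_tree_component eH C -> dsum eH C <= 2 * q ->
  [disjoint C & I] -> (forall u v, u \in I -> ~~ eH u v) ->
  X != set0 -> (#|I| + 6 * q) * #|X| <= dsum e X ->
  model eH (C :|: I) e X.
Proof.
move=> sgH sg q0 cC ntC leC dCI iso X0 leX.
set d := #|I| + 6 * q in leX.
pose L n w := (0 < n) && (d * n <= w).
apply: (@minor_descent _ eH _ VG L) => //; last by rewrite /L card_gt0 X0.
  by move=> n w w' lew /andP[n0 le1]; rewrite /L n0 (leq_trans le1).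
move=> {sg X0 leX} {}e {}X sg /andP[n0 leX] noC noD.
have [sym irr] := sg; have bnd := dsum_bound X irr.
have [v vX vmin] : exists2 v, v \in X & #|X| * #|nb e X v| <= dsum e X.
  by apply: exists_min_degree; rewrite -card_gt0.
set w := dsum e X in leX noC noD bnd vmin.
have ltdX : d < #|X|.
  by rewrite -(leq_pmul2r n0); move: n0 (leq_trans leX bnd); clear; nia.
have n1 : 0 < #|X|.-1 by move: ltdX q0; rewrite /d; clear; lia.
have loss a : ~~ L #|X|.-1 (w - a) -> w < d * #|X|.-1 + a.
  by rewrite /L n1 /= -ltnNge; clear; lia.
pose Z := v |: nb e X v.
have degZ u : u \in Z -> w < d * #|X|.-1 + 2 * #|nb e Z u|.
  move=> uZ; have [le|[uX evu lt]] := closed_nbhd_degree sg vX uZ.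
    by apply: leq_trans (loss _ (noD v vX)) _; rewrite leq_add2l leq_mul2l le.
  apply: leq_trans (loss _ (noC v u vX uX evu)) _.
  by rewrite -mulnS leq_add2l leq_mul2l lt.
have cZ : #|Z| = #|nb e X v|.+1 by rewrite cardsU1 inE irr andbF.
have sZX : Z \subset X.
  by rewrite subUset sub1set vX; apply/subsetP=> u; rewrite inE => /andP[].
(* With [n = #|X|], [d <= w / n] gives [w - d (n - 1) >= w / n], which is at least [d] and at least
   the degree of [v]. *)
have half_deg u : u \in Z -> #|Z| <= 2 * #|nb e Z u| /\ d < 2 * #|nb e Z u|.
  move=> /degZ; rewrite cZ; move: leX vmin n0; clear; move: #|X| #|nb e X v| => [//|n] D.
  by move: #|_| => a /= h1 h2 _ h3; split; nia.
have leZ : #|Z| * #|Z|.-1 <= 2 * dsum e Z.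
  rewrite -sum_nat_const /dsum big_distrr /=; apply: leq_sum => u /half_deg[+ _].
  by clear; lia.
have leZ' : 6 * q * #|Z| <= 2 * dsum e Z.
  rewrite mulnC -sum_nat_const /dsum big_distrr /=; apply: leq_sum => u /half_deg[_].
  by rewrite /d; clear; lia.
(* A [Z] with more than [6 q + 1] vertices passes its density, at least 1/2, to a subset of exactly
   that size, of average degree at least [3 q]. *)
have [Y [sYZ cY Y0 leY]] : exists Y : {set VG}, [/\ Y \subset Z, #|Y| <= 6 * q + 1,
    0 < #|Y| & 6 * q * #|Y| <= 2 * dsum e Y].
  have [le|lt] := leqP #|Z| (6 * q + 1); first by exists Z; split; rewrite // cZ.
  have [Y [sYZ cY leY]] := dense_subset sg (ltnW lt) leZ.
  exists Y; rewrite cY; split=> //; first by clear; lia.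
  by move: leY; clear; rewrite addn1 /= mulnC.
have [sCX sIY] : model eH C e Y /\ model eH I e (X :\: Y).
  split.
    have leqY : q <= #|Y|.
      have := leq_trans leY (leq_mul (leqnn 2) (dsum_bound Y irr)).
      by move: Y0; clear; case: #|Y| => // y _ /=; nia.
    apply: (model_dense sgH sg q0 cC ntC leC) => //.
    apply: le_trans (ler_wpM2l (ler0n _ _) (threshold_6q q0 leqY cY)) _.
    by rewrite -natrM -natrM ler_nat; move: leY; clear; lia.
  (* [X] has at least [#|I| + 6 q + 1] vertices and [Y] takes at most [6 q + 1]. *)
  apply: model_isolated => //; have := cardsD X Y.
  rewrite (setIidPr (subset_trans sYZ sZX)); move: cY ltdX; rewrite /d; clear; lia.
have sYX := subset_trans sYZ sZX.
rewrite -(setID X Y) (setIidPr sYX); apply: model_union => //.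
  by rewrite disjoint_sym disjoints_subset; apply: subsetDr.
by move=> a b _ bI; rewrite [eH a b](proj1 sgH) iso.
Qed.

(** * Assembling the minor *)

Lemma dsum_setD (V : finType) (e : rel V) (X Y : {set V}) :
  simple_graph e -> Y \subset X ->
  dsum e X <= dsum e (X :\: Y) + 2 * #|Y| * #|X|.
Proof.
move=> sg; have [n] := ubnP #|Y|; elim: n X Y => // n IH X Y ltn sYX.
have [->|[y yY]] := set_0Vmem Y; first by rewrite setD0 leq_addr.
have yX := subsetP sYX y yY; have cY := cardsD1 y Y; rewrite yY in cY.
have := IH (X :\ y) (Y :\ y); rewrite setDDl setD1K // => /(_ _ _)/wrap[].
- by move: ltn cY; clear; lia.
- exact: setSD.
have := dsum_del sg yX; have := nb_ltn (proj2 sg) yX; have := cardsD1 y X.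
rewrite yX cY; clear; move: (dsum _ _) (dsum _ _) (dsum _ _) #|X :\ y| #|Y :\ y| #|X|.
by move=> a b c x y' x'; nia.
Qed.

(** The last hypothesis handles the empty G, where the degree condition reads [0 <= 0]. *)
Lemma minor_degree_sum (VH : finType) (eH : rel VH) (VG : finType) (eG : rel VG) (q : nat) :
  simple_graph eH -> simple_graph eG -> dsum eH [set: VH] <= 2 * q ->
  (num_isolated eH + 6 * q) * #|VG| <= dsum eG [set: VG] ->
  (0 < num_isolated eH + q -> 0 < #|VG|) ->
  is_minor eH eG.
Proof.
move=> sgH sg leq leG n0.
suff [phi [_ con dis adj]] : model eH [set: VH] eG [set: VG].
  by exists phi; split=> [v|u v|u v]; [apply: con|apply: dis|apply: adj]; rewrite ?inE.
have [symH irrH] := sgH; have [sym irr] := sg.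
set I := isolated_vertices eH.
have isoP u : reflect (forall v, ~~ eH u v) (u \in I).
  by rewrite inE; apply: forallP.
have cD : closed_set eH (~: I).
  apply/closed_setP=> u v _ euv; rewrite inE; apply/isoP=> /(_ u).
  by rewrite symH euv.
have [F [sFD cF dF ntC]] := split_trees sgH cD; set C := ~: I :\: F in ntC.
have cC : closed_set eH C by apply: closed_setD.
(* No vertex of [F] is isolated, so [F] has at most two vertices per edge. *)
have leF : #|F| <= dsum eH F.
  rewrite -sum1_card; apply: leq_sum => u uF; apply/card_gt0P.
  have := subsetP sFD u uF; rewrite inE => /isoP/forallP.
  rewrite negb_forall => /existsP[v]; rewrite negbK => euv; exists v.
  by rewrite inE euv (closed_setP _ _ cF u v).
have leFC : dsum eH F + dsum eH C <= 2 * q.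
  rewrite -(dsum_closedD symH cF sFD); apply: leq_trans leq; exact/dsum_sub/subsetT.
have pos : 0 < #|I| + #|F| + dsum eH C -> 0 < #|VG|.
  by move=> p; apply: n0; move: p leF leFC; rewrite /num_isolated -/I; clear; lia.
(* Minimum degree [#|F|] is obtained from average degree [2 * #|F|], at most 4 per edge of [F]. *)
have [Y [cY mY]] : exists Y : {set VG}, #|Y| <= #|F| /\ model eH F eG Y.
  have [F0|F0] := eqVneq F set0.
    exists set0; rewrite cards0; split=> //; rewrite F0.
    by apply: model_isolated => [u v|]; rewrite ?inE ?cards0.
  have [||Z [_ Z0 degZ]] := @min_degree_subgraph _ eG [set: VG] #|F| sg.
  - by rewrite -card_gt0 cardsT; apply: pos; rewrite -card_gt0 in F0; move: F0; clear; lia.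
  - rewrite cardsT; apply: leq_trans leG; rewrite leq_mul2r; apply/orP; right.
    by move: leF leFC; clear; lia.
  have [r [phi sm]] := star_model_forest sgH sg dF Z0 degZ.
  by have [Y [_ cY mY]] := star_model_model sym sm; exists Y.
have [qC eqC] : exists qC, dsum eH C = 2 * qC.
  exists (dsum eH C)./2; rewrite mul2n -[LHS]odd_double_half.
  by rewrite (negPf (even_dsum C sgH)).
(* Deleting [Y] costs at most [2 * #|VG|] per vertex, so at most [4 * #|VG|] per edge of [F], out of
   the [6 * #|VG|] available. *)
have leX : (#|I| + 6 * qC) * #|VG| <= dsum eG (~: Y).
  have := dsum_setD sg (subsetT Y); rewrite -setTD cardsT.
  move: leG leF leFC cY; rewrite eqC /num_isolated -/I; clear.
  move: (dsum _ _) (dsum _ _) (dsum _ _) #|Y| #|F| #|I| #|VG| => a b c y f i n.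
  move=> h1 h2 h3 h4 h5; have : 2 * y * n + (i + 6 * qC) * n <= (i + 6 * q) * n.
    by rewrite -mulnDl leq_mul2r; apply/orP; right; lia.
  by lia.
have cYn : #|~: Y| <= #|VG| by apply: max_card.
have dCI : [disjoint C & I].
  by rewrite disjoints_subset; apply: subsetDl.
have iso u v : u \in I -> ~~ eH u v by move/isoP.
have mCI : model eH (C :|: I) eG (~: Y).
  have [qC0|qC0] := posnP qC.
    have -> : C = set0.
      apply/eqP; apply: contraT => C0; have := ntC C (subxx _) cC C0.
      by rewrite eqC qC0 leqn0 muln_eq0 /= cards_eq0 (negPf C0).
    rewrite set0U; apply: model_isolated => //; have [->//|I0] := posnP #|I|.
    have VG0 : 0 < #|VG| by apply: pos; move: I0; clear; lia.
    move: (dsum_bound (~: Y) irr) leX cYn I0 VG0; rewrite qC0; clear.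
    by move: (dsum _ _) #|I| #|VG| #|~: Y| => a i n [|y]; nia.
  have VG0 : 0 < #|VG| by apply: pos; rewrite eqC; move: qC0; clear; lia.
  apply: (model_sparse sgH sg qC0 cC ntC _ dCI iso); first by rewrite eqC.
    apply/eqP=> Y0; move: leX; rewrite Y0 /dsum big_set0.
    by move: VG0 qC0; clear; nia.
  by apply: leq_trans leX; rewrite leq_mul2l cYn orbT.
have -> : [set: VH] = F :|: (C :|: I).
  apply/setP=> u; rewrite !(in_setU, in_setD, in_setC, in_setT).
  by case: (u \in F); case: (u \in I).
rewrite -(setUCr Y); apply: model_union => //.
- by rewrite disjoints_subset setCK.
- rewrite disjoints_subset; apply/subsetP=> u uF; have := subsetP sFD u uF.
  by rewrite !inE uF => /negPf->.
have noFCI u v : u \in F -> v \in C :|: I -> ~~ eH u v.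
  move=> uF vCI; apply/negP=> euv; have vF := closed_setP _ _ cF u v uF euv.
  move: vCI; rewrite inE => /orP[|/isoP/(_ u)]; last by rewrite symH euv.
  by rewrite inE vF.
by move=> u v uF vCI; split; [|rewrite symH]; apply: noFCI.
Qed.

Lemma minor_average_degree (VH : finType) (eH : rel VH) (VG : finType)
    (eG : rel VG) (c : rat) :
  simple_graph eH -> simple_graph eG -> (6%:R <= c)%R ->
  ((num_isolated eH)%:R + c * (num_edges eH)%:R <= average_degree eG)%R ->
  is_minor eH eG.
Proof.
move=> sgH sg le6c lec.
have {le6c lec} le : ((num_isolated eH + 6 * num_edges eH)%:R <= average_degree eG)%R.
  by apply: le_trans lec; rewrite natrD natrM lerD2l ler_wpM2r ?ler0n.
apply: (minor_degree_sum sgH sg (dsum_le_num_edges eH)) => [|pos].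
  have eqd : dsum eG [set: VG] = \sum_v deg eG v.
    rewrite /dsum; apply: eq_big => [u|u _]; first by rewrite inE.
    by apply: eq_card => w; rewrite !inE.
  have [->|VG0] := posnP #|VG|; first by rewrite muln0.
  by rewrite eqd -(ler_nat rat) natrM -ler_pdivlMr ?ltr0n.
(* The average degree of an empty G is [0 / 0 = 0], so H would have neither isolated vertices nor
   edges. *)
rewrite lt0n; apply: contraTneq le => VG0.
rewrite /average_degree VG0 invr0 mulr0 -ltNge ltr0n.
by move: pos; clear; lia.
Qed.

Theorem theorem15 (VH : finType) (eH : rel VH) (VG : finType) (eG : rel VG) :
  simple_graph eH -> simple_graph eG ->
  ((num_isolated eH)%:R + (6929%:R / 1000%:R) * (num_edges eH)%:R
     <= average_degree eG :> rat)%R ->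
  is_minor eH eG.
Proof.
move=> sgH sg; refine (minor_average_degree sgH sg _).
rewrite ler_pdivlMr; last by rewrite ltr0n.
by rewrite -natrM ler_nat; vm_compute.
Qed.
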